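(* Let $K$ be a field and let $I\subseteq K[x_1,\ldots,x_n]$ be a nonzero proper square-free monomial ideal which satisfies the packing property. Then $\widehat{\alpha}(I)=\alpha(I)$.
   Context: A square-free monomial ideal of $K[x_1,\ldots,x_n]$ is an ideal generated by square-free monomials; it has a unique irredundant decomposition $I=P_1\cap\cdots\cap P_s$ with each $P_j$ a prime ideal generated by a subset of the variables. Its height $\mathrm{ht}(I)$ is the minimum over $j$ of the number of variables generating $P_j$. For $m\ge 1$ the $m$-th symbolic power is $I^{(m)}=P_1^m\cap\cdots\cap P_s^m$. A square-free monomial ideal $I$ is König if there is a set of pairwise coprime monomials in $I$ of cardinality $\mathrm{ht}(I)$. The ideal $I$ has the packing property if every ideal obtained from $I$ by setting a (possibly empty) subset of the variables equal to $0$ and a disjoint (possibly empty) subset of the variables equal to $1$ is König. (Convention: the zero ideal and the unit ideal, which may arise this way, are regarded as König.) For a nonzero homogeneous ideal $J$, the initial degree $\alpha(J)$ is the least degree of a nonzero element of $J$. The Waldschmidt constant of $I$ is $\widehat{\alpha}(I)=\lim_{m\to\infty}\frac{\alpha(I^{(m)})}{m}$ (the limit exists and equals the infimum of the sequence, by subadditivity). *)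

(* Defs.v *)
From HB Require Import structures.
From mathcomp Require Import all_boot all_order all_algebra.
From mathcomp Require Import mpoly.
From mathcomp Require Import boolp classical_sets reals topology.

Set Implicit Arguments.
Unset Strict Implicit.
Unset Printing Implicit Defensive.

Import Order.TTheory GRing.Theory Num.Theory.
Import numFieldTopology.Exports.

Local Open Scope classical_set_scope.
Local Open Scope ring_scope.

(* MathComp has no ideals that may be improper, so an ideal of K[x_1..x_n] is
   handled as its underlying set of polynomials; variables are indexed by
   'I_n. *)
Section Ideals.
Variables (K : fieldType) (n : nat).
Implicit Types (I J S : set {mpoly K[n]}) (A Z U : {set 'I_n}).

(* The ideal generated by S; it is the zero ideal when S is empty. *)
Definition ideal_gen S : set {mpoly K[n]} :=
  [set p | exists (k : nat) (c g : 'I_k -> {mpoly K[n]}),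
      (forall i, S (g i)) /\ p = \sum_(i < k) c i * g i].

Definition ideal_exp I (m : nat) : set {mpoly K[n]} :=
  ideal_gen [set p | exists g : 'I_m -> {mpoly K[n]},
      (forall i, I (g i)) /\ p = \prod_(i < m) g i].

Definition squarefree_mnm (a : 'X_{1..n}) : Prop := forall i, (a i <= 1)%N.

Definition squarefree_monomial_ideal I : Prop :=
  exists2 G : set 'X_{1..n}, (forall a, G a -> squarefree_mnm a)
    & I = ideal_gen [set 'X_[a] | a in G].

Definition var_prime A : set {mpoly K[n]} := ideal_gen [set 'X_i | i in [set` A]].

(* A family of primes var_prime A is represented by the set D of their index
   sets A. The unit ideal is the empty intersection. *)
Definition irredundant_decomposition I (D : {set {set 'I_n}}) : Prop :=
  I = \bigcap_(A in [set` D]) var_prime A /\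
  forall B, B \in D -> I <> \bigcap_(A in [set` D :\ B]) var_prime A.

(* The irredundant decomposition of a square-free monomial ideal exists and is
   unique, so xget returns it; the default value finset.set0 is never used there. *)
Definition decomposition I : {set {set 'I_n}} :=
  xget finset.set0 [set D | irredundant_decomposition I D].

(* A minimum of cardinals, all of them at most n, so the initial value n only
   matters for the unit ideal, whose decomposition is empty. *)
Definition height I : nat := \big[minn/n]_(A in decomposition I) #|A|.

Definition symbolic_power I (m : nat) : set {mpoly K[n]} :=
  \bigcap_(A in [set` decomposition I]) ideal_exp (var_prime A) m.

Definition coprime_mnm (a b : 'X_{1..n}) : Prop :=
  forall i, a i = 0%N \/ b i = 0%N.

(* The zero ideal and the unit ideal are Konig by convention. *)
Definition konig I : Prop :=
  [\/ I = [set 0], I = setT |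
   exists s : seq 'X_{1..n},
     [/\ uniq s, size s = height I,
         (forall a, a \in s -> I 'X_[a]) &
         (forall a b, a \in s -> b \in s -> a != b -> coprime_mnm a b)]].

(* The ideal obtained from I by setting the variables of Z to 0 and those of U
   to 1; it is kept in the same polynomial ring, where it is generated by
   polynomials in the remaining variables. *)
Definition specialize Z U I : set {mpoly K[n]} :=
  let v := [tuple (if i \in Z then 0 else if i \in U then 1 else 'X_i)
             : {mpoly K[n]} | i < n] in
  ideal_gen [set p \mPo v | p in I].

Definition packing_property I : Prop :=
  forall Z U, [disjoint Z & U]%B -> konig (specialize Z U I).

(* The total degree of a nonzero p is (msize p).-1. *)
Definition initial_degree J : nat :=
  xget 0%N [set d | (exists2 p, J p & p != 0 /\ (msize p).-1 = d) /\
                    (forall p, J p -> p != 0 -> (d <= (msize p).-1)%N)].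

(* limn of a divergent sequence is 0; the term at m = 0 is x / 0 = 0. *)
Definition waldschmidt (R : realType) I : R :=
  limn (fun m : nat => (initial_degree (symbolic_power I m))%:R / m%:R : R).

End Ideals.

(* Main.v *)
(* Let H be the clutter of supports of the minimal generators of I, so that the
   index sets of the minimal primes of I are the minimal covers of H.  Following
   Lehman, the packing property implies that H is ideal: every fractional cover
   dominates a convex combination of covers.  In a minimal counterexample some
   vertex z of the fractional cover polyhedron has 0 < z < 1, and N = |V(H)|
   linearly independent edges are tight at z.  As the deletions of H are ideal,
   a rank argument gives |e| <= deg j for each of these edges e and each vertex
   j not in e; double counting then yields positive weights on the tight edges
   with constant sum through every vertex.  Weighing a cover of the size of a
   packing shows that it meets each tight edge exactly once, hence that z is
   integral.  Finally, apply idealness to the constant fractional cover 1/d,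
   where d is the least size of an edge: a monomial x^a of I^(m) satisfies
   sum_{i in c} a_i >= m for every cover c, hence deg x^a >= m d, so that the
   initial degree of I^(m) is exactly m d. *)
Require Import Defs.
From mathcomp Require Import all_boot all_order all_algebra.

Set Implicit Arguments.
Unset Strict Implicit.
Unset Printing Implicit Defensive.
Import Order.TTheory GRing.Theory Num.Theory.
Local Open Scope ring_scope.

(** * Zero-one matrices *)

Section Incidence.
Variable F : realFieldType.

Lemma sum_indic (T : finType) (A B : {pred T}) :
  \sum_(x in A) (x \in B)%:R = #|[predI A & B]|%:R :> F.
Proof.
rewrite -sum1_card natr_sum big_mkcond [RHS]big_mkcond /=.
by apply: eq_bigr => x _; rewrite inE /=; case: (x \in A); case: (x \in B).
Qed.

(** Rank count: [A] stacks the unit row at [j] on the rows of [M] avoiding [j], and the columns of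
    [B] are the indicators of the sets [b v] for v in [a i]. Both have full rank, while [A *m B] is
    the all-one matrix of rank at most 1, so Sylvester's inequality bounds the sum of the two ranks
    by N + 1. *)
Lemma row_size_le_col_size N (a : 'I_N -> {set 'I_N}) (i j : 'I_N)
    (b : 'I_N -> {set 'I_N}) :
    \matrix_(k, v) (v \in a k)%:R \in (unitmx : pred 'M[F]_N) ->
    j \notin a i ->
    (forall v, v \in a i -> [/\ v \in b v, j \in b v &
        forall k, j \notin a k -> #|a k :&: b v| = 1%N]) ->
  (#|a i| <= #|[set k | j \in a k]|)%N.
Proof.
set M := \matrix_(k, v) _ => uM jai hb.
have ME k v : M k v = (v \in a k)%:R by rewrite mxE.
set S := [set k | j \notin a k]; set R := a i.
pose sel (X : {set 'I_N}) : 'M[F]_(#|X|, N) := rowsub enum_val 1%:M.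
pose A := col_mx (delta_mx 0 j : 'rV[F]_N) (sel S *m M).
pose B : 'M[F]_(N, #|R|) := \matrix_(k, v) (k \in b (enum_val v))%:R.
have selM p (X : {set 'I_N}) (C : 'M_(N, p)) x y :
    (sel X *m C) x y = C (enum_val x) y.
  by rewrite /sel -rowsubE mxE.
have sel_free X : row_free (sel X).
  apply/row_freeP; exists (sel X)^T; apply/matrixP => x y.
  by rewrite selM !mxE (inj_eq enum_val_inj) eq_sym.
(* Column [j] vanishes on the lower block, which separates off the unit row; the other rows are
   independent because [M] is invertible. *)
have A_free : row_free A.
  apply: inj_row_free => v; rewrite -[v]hsubmxK mul_row_col.
  set x := lsubmx v; set w := rsubmx v => vA.
  have x0 : x = 0.
    have /matrixP /(_ 0 j) := vA.
    rewrite mxE [X in _ + X]mxE /= big1 ?addr0 => [|k _]; last first.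
      rewrite selM ME; have := enum_valP k; rewrite inE => /negbTE ->.
      by rewrite mulr0.
    rewrite [RHS]mxE mxE big_ord1 [delta_mx _ _ _ _]mxE !eqxx mulr1 => x0.
    by apply/matrixP => p q; rewrite !ord1 x0 mxE.
  move: vA; rewrite x0 mul0mx add0r => /eqP.
  rewrite mulmxA mulmx_free_eq0 ?row_free_unit // mulmx_free_eq0 // => /eqP ->.
  by rewrite row_mx0.
(* Each [b v] meets [a i] exactly in [v], so the rows of [B] indexed by [R] form an identity
   matrix. *)
have rB : (#|R| <= \rank B)%N.
  suff selB : sel R *m B = 1%:M.
    by have := mxrankM_maxr (sel R) B; rewrite selB mxrank1.
  apply/matrixP => x y; rewrite selM !mxE; congr (_%:R); congr nat_of_bool.
    have yR := enum_valP y; have xR := enum_valP x.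
    have [yb _ /(_ i jai) /eqP /cards1P [t tE]] := hb _ yR.
    have /set1P ty : enum_val y \in [set t] by rewrite -tE inE yR yb.
    have := in_set1 (enum_val x) t.
    by rewrite -tE inE xR /= => ->; rewrite -ty (inj_eq enum_val_inj).
have AB : A *m B = const_mx 1 *m (const_mx 1 : 'rV[F]_#|R|).
  apply/matrixP => x y; transitivity (1 : F); last by rewrite mxE big_ord1 !mxE mulr1.
  have yR := enum_valP y; have [_ jb kb] := hb _ yR.
  rewrite /A mul_col_mx -[x]splitK; case: (split x) => p /=.
    rewrite col_mxEu -rowE !mxE; by rewrite jb.
  rewrite col_mxEd -mulmxA selM mxE.
  have := enum_valP p; rewrite inE => /kb ck.
  rewrite -[RHS]/(1%:R) -ck.
  transitivity (\sum_(k in a (enum_val p)) (k \in b (enum_val y))%:R : F).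
    rewrite [RHS]big_mkcond; apply: eq_bigr => k _; rewrite !mxE.
    by case: (k \in a _); rewrite ?mul1r ?mul0r.
  by rewrite sum_indic; congr (_%:R); apply: eq_card => k; rewrite !inE.
have := leq_trans (mxrank_mul_min A B) (eq_leq (congr1 mxrank AB)).
move/leq_trans/(_ (mulmx_max_rank _ _)).
rewrite (eqP A_free) leq_subLR => h.
have cS : (#|S| + #|[set k | j \in a k]| = N)%N.
  rewrite addnC -[RHS]card_ord -(cardsC [set k | j \in a k]); congr addn.
  by apply: eq_card => k; rewrite !inE.
rewrite -(leq_add2l #|S|) cS -ltnS -addn1 addnAC [(#|S| + 1)%N]addnC -[N.+1]addn1.
by apply: leq_trans h; rewrite leq_add2l.
Qed.

(* de Bruijn-Erdos double counting over the zero entries. *)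
Lemma constant_column_weights N (a : 'I_N -> {set 'I_N}) :
    (0 < N)%N ->
    (forall i, #|a i| < N)%N ->
    (forall j, 0 < #|[set i | j \in a i]| < N)%N ->
    (forall i j, j \notin a i -> (#|a i| <= #|[set i | j \in a i]|)%N) ->
  exists (y : 'I_N -> F) (kappa : F), [/\ 0 < kappa, forall i, 0 < y i &
    forall j, \sum_(i | j \in a i) y i = kappa].
Proof.
move=> N0 ltr ltc le_rc; set c := fun j => #|[set i | j \in a i]|.
(* Reciprocals of the numbers of zeros in row [i] and in column [j]. They sum to 1 over the zeros of
   each row and column, so the nonnegative differences [w j - y i] over all zeros total N - N = 0
   and all vanish. *)
pose y i : F := (N - #|a i|)%:R^-1; pose w j : F := (N - c j)%:R^-1.
have y_gt0 i : 0 < y i by rewrite invr_gt0 ltr0n subn_gt0.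
have ltcN j : (c j < N)%N by case/andP: (ltc j).
have le_yw i j : j \notin a i -> y i <= w j.
  move=> ji; rewrite lef_pV2 ?posrE ?ltr0n ?subn_gt0 // ler_nat.
  exact/leq_sub2l/le_rc.
have cardC (X : {set 'I_N}) : #|[pred i | i \notin X]| = (N - #|X|)%N.
  have := cardC X; rewrite card_ord => /(congr1 (subn^~ #|X|)).
  by rewrite /= addKn => <-; apply: eq_card.
have sumw j : \sum_(i | j \notin a i) w j = 1.
  rewrite sumr_const.
  have -> : #|[pred i | j \notin a i]| = (N - c j)%N.
    by rewrite -cardC; apply: eq_card => i; rewrite !inE.
  by rewrite -[LHS]mulr_natl mulfV // pnatr_eq0 -lt0n subn_gt0.
have sumy i : \sum_(j | j \notin a i) y i = 1.
  by rewrite sumr_const cardC -[LHS]mulr_natl mulfV // pnatr_eq0 -lt0n subn_gt0.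
have tot : \sum_j \sum_(i | j \notin a i) (w j - y i) = 0.
  under eq_bigr do rewrite sumrB sumw.
  rewrite sumrB (exchange_big_dep predT) //=.
  by under [X in _ - X]eq_bigr do rewrite sumy; rewrite subrr.
have eq_yw i j : j \notin a i -> y i = w j.
  move=> ji.
  have ge0 i' j' : j' \notin a i' -> 0 <= w j' - y i'.
    by move=> h; rewrite subr_ge0 le_yw.
  have tj : \sum_(i' | j \notin a i') (w j - y i') = 0.
    exact: (psumr_eq0P (fun j' _ => sumr_ge0 _ (ge0^~ j')) tot).
  have := psumr_eq0P (ge0^~ j) tj ji.
  by move/eqP; rewrite subr_eq0 => /eqP.
(* The rows avoiding [j] each have weight [w j], hence total 1; the rows through [j] carry the
   rest. *)
exists y, (\sum_i y i - 1); split=> // [|j].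
  pose j0 := Ordinal N0; rewrite subr_gt0 -(sumw j0) (bigID (fun i => j0 \in a i) predT) /=.
  under [X in _ < _ + X]eq_bigr => i ji do rewrite (eq_yw _ _ ji).
  rewrite ltrDr; have /andP[+ _] := ltc j0; rewrite card_gt0 => /set0Pn [i].
  rewrite inE => ji; rewrite (bigD1 i) //= ltr_pwDl //.
  by apply: sumr_ge0 => k _; apply: ltW.
rewrite [in RHS](bigID (fun i => j \in a i)) /=.
under [X in _ = _ + X - 1]eq_bigr => i ji do rewrite (eq_yw _ _ ji).
by rewrite sumw addrK.
Qed.
End Incidence.

(** * Lehman's theorem for clutters with the packing property *)

Section Clutters.
Variables (F : realFieldType) (T : finType).
Implicit Types (E S : {set {set T}}) (e c W Z U : {set T}) (z u : T -> F).

(** * Covers, fractional covers and convex combinations of covers *)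

Definition is_cover E c := [forall e in E, [exists i in e, i \in c]].

Lemma is_coverP E c :
  reflect (forall e, e \in E -> exists2 i, i \in e & i \in c) (is_cover E c).
Proof.
by apply: (iffP forall_inP) => h e /h => [/exists_inP|] //; move/exists_inP.
Qed.

Definition fractional_cover E z :=
  (forall i, 0 <= z i) /\ (forall e, e \in E -> 1 <= \sum_(i in e) z i).

(** The index type is arbitrary so that two combinations can be joined over a sum type; strictly
    positive weights make complementary slackness apply to every cover of the family. *)
Definition dominates_covers E z :=
  exists (I : finType) (c : I -> {set T}) (l : I -> F),
    [/\ forall k, 0 < l k, \sum_k l k = 1, forall k, is_cover E (c k)
      & forall i, \sum_(k | i \in c k) l k <= z i].

Lemma dominates_covers_le E z z' :
  dominates_covers E z -> (forall i, z i <= z' i) -> dominates_covers E z'.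
Proof.
move=> [I [c [l [l0 l1 cE lz]]]] zz'; exists I, c, l; split=> // i.
exact: le_trans (lz i) (zz' i).
Qed.

Lemma dominates_covers_convex E z z' (t : F) : 0 < t < 1 ->
  dominates_covers E z -> dominates_covers E z' ->
  dominates_covers E (fun i => t * z i + (1 - t) * z' i).
Proof.
move=> /andP[t0 t1] [I [c [l [l0 l1 cE lz]]]] [I' [c' [l' [l'0 l'1 c'E l'z]]]].
have t'0 : 0 < 1 - t by rewrite subr_gt0.
exists (I + I')%type, (fun k => match k with inl k => c k | inr k => c' k end),
  (fun k => match k with inl k => t * l k | inr k => (1 - t) * l' k end).
split=> [[k|k]||[k|k]|i] //; rewrite ?mulr_gt0 //.
- by rewrite big_sumType /= -!mulr_sumr l1 l'1 !mulr1 addrC subrK.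
- by rewrite big_sumType /= -!mulr_sumr lerD // ler_wpM2l // ltW.
Qed.

(** * Deletion, contraction and the packing property *)

Definition deletion E (j : T) := [set e in E | j \notin e].
Definition contraction E (j : T) := [set e :\ j | e in E].

(** Adjoining [j] to the covers of the deletion also covers the edges through [j]; this puts total
    weight 1 on [j], which [1 <= z j] allows. *)
Lemma dominates_covers_deletion E z j :
  dominates_covers (deletion E j) z -> 1 <= z j -> dominates_covers E z.
Proof.
move=> [I [c [l [l0 l1 cE lz]]]] zj; exists I, (fun k => j |: c k), l.
split=> // [k|i].
  apply/is_coverP => e eE; have [je|je] := boolP (j \in e).
    by exists j; rewrite // !inE eqxx.
  have /is_coverP/(_ e) := cE k; rewrite inE eE je => /(_ isT) [x xe xc].
  by exists x; rewrite // !inE xc orbT.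
have [->|ij] := eqVneq i j.
  apply: le_trans zj; rewrite -l1 [leRHS](bigID (fun k => j \in j |: c k)) /=.
  by rewrite lerDl; apply: sumr_ge0 => k _; apply: ltW.
apply: le_trans (lz i); rewrite le_eqVlt; apply/orP; left; apply/eqP.
by apply: eq_bigl => k; rewrite !inE (negbTE ij).
Qed.

Lemma dominates_covers_contraction E z j :
  dominates_covers (contraction E j) z -> dominates_covers E z.
Proof.
move=> [I [c [l [l0 l1 cE lz]]]]; exists I, c, l; split=> // k.
apply/is_coverP => e eE; have /is_coverP/(_ (e :\ j)) := cE k.
move=> /(_ (imset_f _ eE)) [x]; rewrite !inE => /andP[_ xe] xc.
by exists x.
Qed.

Lemma fractional_cover_deletion E z j :
  fractional_cover E z -> fractional_cover (deletion E j) z.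
Proof. by move=> [z0 zE]; split=> // e; rewrite inE => /andP[/zE]. Qed.

Lemma fractional_cover_contraction E z j : z j = 0 ->
  fractional_cover E z -> fractional_cover (contraction E j) z.
Proof.
move=> zj [z0 zE]; split=> // _ /imsetP[e /zE + ->].
have [je|je] := boolP (j \in e); first by rewrite (big_setD1 j) //= zj add0r.
by have /setDidPl -> : [disjoint e & [set j]] by rewrite disjoint_sym disjoints1.
Qed.

(** On supports of generators, [Z] collects the variables set to 0 and [U] those set to 1. *)
Definition minor E Z U := [set e :\: U | e in E & [disjoint e & Z]].

(** The Konig property, certified by disjoint edges [s] (the count condition) and a cover that is no
    larger. An empty edge stands for the unit ideal. *)
Definition packs E :=
  set0 \in E \/ exists (s : seq {set T}) (c : {set T}),
    [/\ {subset s <= E}, forall i, (count (fun e => i \in e) s <= 1)%N,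
        is_cover E c & (#|c| <= size s)%N].

Definition packing E := forall Z U, [disjoint Z & U] -> packs (minor E Z U).

Lemma minor0 E : minor E set0 set0 = E.
Proof.
apply/setP => e; apply/imsetP/idP => [[e' + ->]|eE].
  by rewrite inE setD0 => /andP[].
by exists e; rewrite ?setD0 // inE eE -setI_eq0 setI0 eqxx.
Qed.

Lemma packing_packs E : packing E -> packs E.
Proof.
by move=> /(_ set0 set0); rewrite minor0; apply; rewrite -setI_eq0 setI0.
Qed.

Lemma packing_deletion E j : packing E -> packing (deletion E j).
Proof.
move=> pE Z U ZU.
(* [j] leaves [U] to keep the two sets disjoint; this is harmless since no surviving edge contains
   [j]. *)
suff -> : minor (deletion E j) Z U = minor E (j |: Z) (U :\ j).
  apply: pE; rewrite -setI_eq0; apply/eqP/setP => x; rewrite !inE.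
  by have := disjointFr ZU; case: eqVneq => //= _ /(_ x); case: (x \in Z) => // ->.
have disjE e : [disjoint e & j |: Z] = (j \notin e) && [disjoint e & Z].
  by rewrite !disjoints_subset setCU subsetI -setCS setCK sub1set inE.
have eqD e : j \notin e -> e :\: U = e :\: (U :\ j).
  move=> je; apply/setP => x; rewrite !inE; case: eqVneq => //= ->.
  by rewrite (negbTE je) !andbF.
apply/setP => d; apply/imsetP/imsetP => -[e + ->].
  rewrite !inE -andbA => /and3P[eE je eZ]; exists e; last exact: eqD.
  by rewrite inE eE disjE je.
rewrite inE disjE => /and3P[eE je eZ]; exists e; last exact/esym/eqD.
by rewrite !inE eE je.
Qed.

Lemma packing_contraction E j : packing E -> packing (contraction E j).
Proof.
move=> pE Z U ZU.
(* Dually, [j] leaves [Z], since no contracted edge contains it. *)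
suff -> : minor (contraction E j) Z U = minor E (Z :\ j) (j |: U).
  apply: pE; rewrite -setI_eq0; apply/eqP/setP => x; rewrite !inE.
  by have := disjointFr ZU; case: eqVneq => //= _ /(_ x); case: (x \in Z) => // ->.
have eqDis e : [disjoint e :\ j & Z] = [disjoint e & Z :\ j].
  rewrite -!setI_eq0; congr (_ == _); apply/setP => x; rewrite !inE.
  by case: (x \in e); case: (x \in Z); rewrite ?andbF ?andbT.
apply/setP => d; apply/imsetP/imsetP => -[e + ->].
  rewrite inE => /andP[/imsetP[e' e'E ->]]; rewrite eqDis => eZ.
  by exists e'; rewrite ?inE ?e'E // setDDl.
rewrite inE => /andP[eE eZ]; exists (e :\ j); last by rewrite setDDl.
by rewrite inE eqDis eZ andbT; apply: imset_f.
Qed.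

(** * Reduction to the vertices of the fractional cover polyhedron *)

Lemma first_vanishing_time (I : finType) (P : pred I) (s r : I -> F) :
    (forall x, P x -> 0 <= s x) -> (forall x, P x -> r x < 0 -> 0 < s x) ->
    (exists2 x, P x & r x < 0) ->
  exists t : F, [/\ 0 < t, forall x, P x -> 0 <= s x + t * r x &
    exists2 x, P x & r x < 0 /\ s x + t * r x = 0].
Proof.
move=> s0 s1 [x0 Px0 rx0]; pose Q := [pred x | P x && (r x < 0)].
have Q0 : Q x0 by rewrite /= Px0.
(* Ratio test: among the decreasing functions, the one with the least zero vanishes first. *)
case: (arg_minP (fun x => s x / - r x) Q0) => x /andP[Px rx] xmin.
exists (s x / - r x); split.
- by rewrite divr_gt0 ?oppr_gt0 // s1.
- move=> y Py; have [ry|ry] := ltP (r y) 0; last first.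
    by rewrite addr_ge0 ?s0 // mulr_ge0 // divr_ge0 ?s0 // oppr_ge0 ltW.
  have /xmin : Q y by rewrite /= Py.
  rewrite [X in _ <= X -> _]/= ler_pdivlMr ?oppr_gt0 // mulrN => h.
  by rewrite -(opprK (_ * r y)) subr_ge0.
- by exists x => //; split=> //; rewrite invrN mulrN mulNr divfK ?subrr ?lt_eqF.
Qed.

Definition tight E z := [set e in E | \sum_(i in e) z i == 1].

(** One ratio test runs over the sign and edge constraints together, indexed by [T + {set T}]. Edges
    tight at [z] stay tight, so an edge that stops the motion is newly tight. *)
Lemma move_to_boundary E z u :
    fractional_cover E z -> (forall i, u i < 0 -> 0 < z i) ->
    (forall e, e \in tight E z -> \sum_(i in e) u i = 0) ->
    (exists i, u i < 0) ->
  exists t : F, [/\ 0 < t, fractional_cover E (fun i => z i + t * u i) &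
    (exists2 i, u i < 0 & z i + t * u i = 0) \/
    (exists2 e, e \in tight E (fun i => z i + t * u i) & \sum_(i in e) u i < 0)].
Proof.
move=> [z0 zE] uz ut [i0 ui0].
pose P (x : T + {set T}) := match x with inl _ => true | inr e => e \in E end.
pose s (x : T + {set T}) := match x with inl i => z i | inr e => \sum_(i in e) z i - 1 end.
pose r (x : T + {set T}) := match x with inl i => u i | inr e => \sum_(i in e) u i end.
have sumE e t : \sum_(i in e) (z i + t * u i) = s (inr e) + t * r (inr e) + 1.
  by rewrite big_split /= -mulr_sumr addrAC subrK.
case: (@first_vanishing_time _ P s r) => [[i|e]|[i|e]||t [t0 ht hx]] //=.
- by move=> eE; rewrite subr_ge0 zE.
- by move=> _; apply: uz.
- move=> eE ue; rewrite subr_gt0 lt_def zE // andbT.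
  by apply: contraTneq ue => ze; rewrite ut ?ltxx // inE eE ze eqxx.
- by exists (inl i0).
exists t; split=> //.
  split=> [i|e eE]; first exact: (ht (inl i)).
  by rewrite sumE lerDr; apply: (ht (inr e)).
case: hx => -[i|e] Px [rx sx]; [left|right]; first by exists i.
by exists e => //; rewrite inE [e \in E]Px sumE sx add0r /=.
Qed.

Definition incidence_mx (S : {set {set T}}) W : 'M[F]_(#|S|, #|W|) :=
  \matrix_(k, v) (enum_val v \in (enum_val k : {set T}))%:R.

Lemma sum_enum_val W e (x : T -> F) : e \subset W ->
  \sum_(i in e) x i = \sum_(v < #|W| | enum_val v \in e) x (enum_val v).
Proof.
move=> eW; rewrite (eq_bigl (fun i => (i \in W) && (i \in e))) => [|i].
  exact: big_enum_val_cond.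
by rewrite andb_idl // => /(subsetP eW).
Qed.

Lemma incidence_mxM S W (x : T -> F) (k : 'I_#|S|) : (forall e, e \in S -> e \subset W) ->
  (incidence_mx S W *m \col_v x (enum_val v)) k 0 =
    \sum_(i in (enum_val k : {set T})) x i.
Proof.
move=> SW; rewrite (sum_enum_val _ (SW _ (enum_valP k))) mxE [RHS]big_mkcond.
by apply: eq_bigr => v _; rewrite !mxE; case: ifP; rewrite ?mul1r ?mul0r.
Qed.

Lemma edge_sub_cover E e : e \in E -> e \subset cover E.
Proof. exact: bigcup_sup. Qed.

(* Induction on the corank of the tight edges: a point that is not a vertex is
   moved both ways along a line on which the tight edges stay tight. *)
Lemma dominates_covers_from_vertices E :
    (forall z j, fractional_cover E z -> j \in cover E -> z j = 0 \/ 1 <= z j ->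
       dominates_covers E z) ->
    (forall z, fractional_cover E z -> (forall j, j \in cover E -> 0 < z j < 1) ->
       \rank (incidence_mx (tight E z) (cover E)) = #|cover E| ->
       dominates_covers E z) ->
  forall z, fractional_cover E z -> dominates_covers E z.
Proof.
set W := cover E => Hbd Hvert z.
have [k] := ubnP (#|W| - \rank (incidence_mx (tight E z) W))%N.
elim: k z => // k IH z; rewrite ltnS => le_k zE.
have tW z' e : e \in tight E z' -> e \subset W.
  by rewrite inE => /andP[/edge_sub_cover].
have [/existsP[j /andP[jW /orP zj]]|] :=
  boolP [exists j, (j \in W) && ((z j == 0) || (1 <= z j))].
  apply: (Hbd z j) => //; case: zj; [by move/eqP; left|by right].
rewrite negb_exists => /forallP nbd.
have z01 j : j \in W -> 0 < z j < 1.
  move=> jW; have := nbd j; rewrite jW negb_or -ltNge => /andP[zj0 ->].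
  by rewrite lt_def zj0 (proj1 zE).
have [/Hvert|neq] := eqVneq (\rank (incidence_mx (tight E z) W)) #|W|; first exact.
set M := incidence_mx _ _ in le_k neq.
have ltr : (\rank M < #|W|)%N by rewrite ltn_neqAle neq rank_leq_col.
(* A nonzero kernel vector of the deficient incidence matrix, extended by 0 outside [W]. *)
have [u [ut [j0 j0W uj0]] uW] : exists u : T -> F,
    [/\ forall e, e \in tight E z -> \sum_(i in e) u i = 0,
        exists2 j, j \in W & u j != 0 & forall j, j \notin W -> u j = 0].
  have : kermx M^T != 0.
    by rewrite kermx_eq0 /row_free mxrank_tr neq.
  case/rowV0Pn => v /sub_kermxP vM v0.
  pose u i := \sum_v' (enum_val v' == i)%:R * v 0 v'.
  have uE w : u (enum_val w) = v 0 w.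
    rewrite /u (bigD1 w) //= eqxx mul1r big1 ?addr0 // => w' ne.
    by rewrite (inj_eq enum_val_inj) (negbTE ne) mul0r.
  exists u; split.
  - move=> e et.
    rewrite -(enum_rankK_in et et) -(@incidence_mxM _ W) //; last exact: tW.
    have -> : \col_v' u (enum_val v') = v^T.
      by apply/matrixP => p q; rewrite !mxE uE ord1.
    by rewrite -[incidence_mx _ _]trmxK -trmx_mul vM !mxE.
  - have /rV0Pn[w vw] := v0; exists (enum_val w); first exact: enum_valP.
    by rewrite uE.
  - move=> j jW; rewrite /u big1 // => w _; case: eqP => [wj|]; last by rewrite mul0r.
    by move: jW; rewrite -wj enum_valP.
(* The motion stops either at a zero coordinate, handled by [Hbd], or at a newly tight edge, which
   lowers the corank. *)
have step u' : (forall e, e \in tight E z -> \sum_(i in e) u' i = 0) ->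
    (forall j, j \notin W -> u' j = 0) -> (exists j, u' j < 0) ->
    exists2 t, 0 < t & dominates_covers E (fun i => z i + t * u' i).
  move=> u't u'W u'neg.
  have inW i : u' i < 0 -> i \in W.
    by apply: contraTT => /u'W ->; rewrite ltxx.
  have [|t [t0 z1E hit]] := move_to_boundary zE _ u't u'neg.
    by move=> i /inW /z01 /andP[].
  exists t => //; set z1 := (fun i => _) in z1E hit *.
  case: hit => [[i ui z1i]|[e et ue]].
    by apply: (Hbd z1 i) => //; [exact: inW|left].
  apply: IH => //; apply: leq_trans le_k; apply: ltn_sub2l => //.
  apply: rank_ltmx; rewrite ltmxE; apply/andP; split.
    apply/row_subP => p; have pt := enum_valP p.
    have pt1 : enum_val p \in tight E z1.
      move: (pt); rewrite !inE => /andP[-> /eqP ez] /=.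
      by rewrite big_split /= -mulr_sumr u't // mulr0 addr0 ez.
    suff -> : row p M = row (enum_rank_in pt1 (enum_val p)) (incidence_mx (tight E z1) W).
      exact: row_sub.
    by apply/rowP => q; rewrite !mxE enum_rankK_in.
  (* The row of the new edge is not in the old span: all old rows annihilate [u'], while the new one
     does not. *)
  apply/negP => /submxP[D MD].
  have : (incidence_mx (tight E z1) W *m \col_v u' (enum_val v)) (enum_rank_in et e) 0 = 0.
    rewrite MD -mulmxA; suff -> : M *m \col_v u' (enum_val v) = 0 by rewrite mulmx0 mxE.
    apply/matrixP => p q; rewrite ord1 incidence_mxM ?[RHS]mxE; last exact: tW.
    exact/u't/enum_valP.
  rewrite incidence_mxM ?enum_rankK_in //; last exact: tW.
  by move=> e0; rewrite e0 ltxx in ue.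
have stepN : (exists j, 0 < u j) ->
    exists2 t, 0 < t & dominates_covers E (fun i => z i - t * u i).
  move=> [j uj]; have [||/=|t t0 h] := step (fun i => - u i).
  - by move=> e et; rewrite sumrN ut // oppr0.
  - by move=> i iW; rewrite uW // oppr0.
  - by exists j; rewrite oppr_lt0.
  by exists t => //; apply: dominates_covers_le h _ => i; rewrite mulrN.
(* If [u] has constant sign, one motion decreases [z], and domination passes up to [z]. Otherwise
   both motions are needed. *)
have [/existsP neg|/existsPn nneg] := boolP [exists j, u j < 0]; last first.
  have u0 i : 0 <= u i by rewrite leNgt.
  have [|t t0] := stepN; first by exists j0; rewrite lt_def uj0 u0.
  move/dominates_covers_le; apply=> i.
  by rewrite gerBl mulr_ge0 // ltW.
have [/existsP pos|/existsPn npos] := boolP [exists j, 0 < u j]; last first.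
  have u0 i : u i <= 0 by rewrite leNgt.
  have [t t0] := step _ ut uW neg.
  move/dominates_covers_le; apply=> i.
  by rewrite gerDl mulr_ge0_le0 // ltW.
have [t t0 ht] := step _ ut uW neg; have [t' t'0 ht'] := stepN pos.
have tt' : 0 < t + t' by rewrite addr_gt0.
(* These weights recover [z] from its two displacements [t * u] and [- t' * u]. *)
have : 0 < t' / (t + t') < 1.
  by rewrite divr_gt0 //= ltr_pdivrMr // mul1r ltrDr.
move=> /dominates_covers_convex /(_ ht ht') /dominates_covers_le; apply=> i.
rewrite le_eqVlt; apply/orP; left; apply/eqP.
have -> : 1 - t' / (t + t') = t / (t + t').
  by rewrite -{1}(divff (lt0r_neq0 tt')) -mulrBl addrK.
rewrite mulrAC [t / _ * _]mulrAC -mulrDl.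
apply: (canLR (mulfK (lt0r_neq0 tt'))).
by rewrite mulrDr mulrBr mulrCA addrACA [t * (t' * _)]mulrCA subrr addr0 -mulrDl mulrC addrC.
Qed.

(* Complementary slackness for the tight edge [e]. *)
Lemma tight_covers E e z (I : finType) (c : I -> {set T}) (l : I -> F) :
    e \in E -> \sum_(i in e) z i = 1 ->
    (forall k, 0 < l k) -> \sum_k l k = 1 -> (forall k, is_cover E (c k)) ->
    (forall i, \sum_(k | i \in c k) l k <= z i) ->
  (forall k, #|e :&: c k| = 1%N) /\
  (forall i, i \in e -> 0 < z i -> exists k, i \in c k).
Proof.
move=> eE ze l0 l1 cE lz.
have ge1 k : (1 <= #|e :&: c k|)%N.
  have /is_coverP/(_ e eE)[i ie ic] := cE k.
  by rewrite card_gt0; apply/set0Pn; exists i; rewrite inE ie.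
have swap : \sum_k l k * #|e :&: c k|%:R = \sum_(i in e) \sum_(k | i \in c k) l k.
  rewrite (exchange_big_dep predT) //=; apply: eq_bigr => k _.
  by rewrite sumr_const mulr_natr; congr (_ *+ _); apply: eq_card => i; rewrite !inE.
have le1 : \sum_(i in e) \sum_(k | i \in c k) l k <= 1.
  by rewrite -ze; apply: ler_sum => i _; apply: lz.
have pos k : 0 <= l k * (#|e :&: c k|%:R - 1).
  by rewrite mulr_ge0 ?(ltW (l0 k)) // subr_ge0 ler1n.
(* Each intersection has at least one element, and their weighted mean is at most 1. *)
have sum0 : \sum_k l k * (#|e :&: c k|%:R - 1) = 0.
  apply/eqP; rewrite eq_le sumr_ge0 ?andbT //.
  under eq_bigr do rewrite mulrBr mulr1.
  by rewrite sumrB swap l1 subr_le0.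
have card1 k : #|e :&: c k| = 1%N.
  have /eqP : l k * (#|e :&: c k|%:R - 1) = 0.
    exact: (psumr_eq0P (fun k _ => pos k) sum0).
  by rewrite mulf_eq0 gt_eqF //= subr_eq0 pnatr_eq1 => /eqP.
split=> // i ie zi.
(* Hence the domination is an equality on [e], and a positive [z i] needs a cover through [i]. *)
have tot : \sum_(i in e) (z i - \sum_(k | i \in c k) l k) = 0.
  rewrite sumrB ze -swap; apply/eqP; rewrite subr_eq0 -[X in X == _]l1; apply/eqP.
  by apply: eq_bigr => k _; rewrite card1 mulr1.
have /eqP : z i - \sum_(k | i \in c k) l k = 0.
  by apply: (psumr_eq0P _ tot ie) => i' _; rewrite subr_ge0.
rewrite subr_eq0 => /eqP zE; rewrite zE in zi.
have [/existsP[k ik]|/existsPn no] := boolP [exists k, i \in c k]; first by exists k.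
by move: zi; rewrite big1 ?ltxx // => k ik; have := no k; rewrite ik.
Qed.

(** * Excluding fractional vertices *)

Lemma card_enum_val_preim W e : e \subset W ->
  #|[set v : 'I_#|W| | enum_val v \in e]| = #|e|.
Proof.
move=> eW; rewrite -(card_imset _ enum_val_inj); apply: eq_card => i.
apply/imsetP/idP => [[v + ->]|ie]; first by rewrite inE.
have iW := subsetP eW _ ie.
by exists (enum_rank_in iW i); rewrite ?inE enum_rankK_in.
Qed.

(* The contradiction in Lehman's theorem: the weights of
   [constant_column_weights] show that a packing of size #|c| forces the cover
   c to meet every tight edge once, so that the vertex would be integral. *)
Lemma packs_no_fractional_vertex E z :
    packs E -> fractional_cover E z -> (0 < #|cover E|)%N ->
    (forall j, j \in cover E -> 0 < z j < 1) ->
    (forall j, j \in cover E -> dominates_covers (deletion E j) z) ->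
    \rank (incidence_mx (tight E z) (cover E)) != #|cover E|.
Proof.
set W := cover E => pE zE N0 z01 delD; apply/negP => fullr.
(* [f] selects as many independent tight edges as there are vertices, giving an invertible square
   matrix [M]. *)
pose f := fullrankfun fullr.
have uM0 := fullrowsub_unit fullr; rewrite -/f in uM0.
pose e k := enum_val (f k) : {set T}.
pose a k := [set v : 'I_#|W| | enum_val v \in e k].
have et k : e k \in tight E z := enum_valP (f k).
have eE k : e k \in E by have := et k; rewrite inE => /andP[].
have eW k : e k \subset W by apply: edge_sub_cover.
have ez k : \sum_(i in e k) z i = 1 by have := et k; rewrite inE => /andP[_ /eqP].
pose zeta (v : 'I_#|W|) := z (enum_val v).
have zeta01 v : 0 < zeta v < 1 by apply: z01; apply: enum_valP.
have sum_a x k : \sum_(v in a k) x (enum_val v) = \sum_(i in e k) x i :> F.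
  by rewrite (sum_enum_val _ (eW k)); apply: eq_bigl => v; rewrite inE.
have az k : \sum_(v in a k) zeta v = 1 by rewrite sum_a ez.
pose M : 'M[F]_#|W| := \matrix_(k, v) (v \in a k)%:R.
have uM : M \in unitmx.
  suff -> : M = rowsub f (incidence_mx (tight E z) W) by [].
  by apply/matrixP => k v; rewrite !mxE inE.
have zeta_uniq x : (forall k, \sum_(v in a k) x v = 1 :> F) -> forall v, x v = zeta v.
  move=> ax v.
  have eqM : M *m \col_v x v = M *m \col_v zeta v.
    apply/matrixP => k q; rewrite !mxE; transitivity (1 : F).
      rewrite -(ax k) [RHS]big_mkcond; apply: eq_bigr => w _.
      by rewrite !mxE; case: ifP; rewrite ?mul1r ?mul0r.
    rewrite -(az k) [LHS]big_mkcond; apply: eq_bigr => w _.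
    by rewrite !mxE; case: ifP; rewrite ?mul1r ?mul0r.
  have /matrixP/(_ v 0) := can_inj (mulKmx uM) eqM.
  by rewrite !mxE.
(* The tight edges avoiding [j] survive in the deletion, so each meets every cover of the
   combination for [deletion E J] exactly once. *)
have le_rc i j : j \notin a i -> (#|a i| <= #|[set k | j \in a k]|)%N.
  move=> jai; set J : T := enum_val j.
  have [I [c [l [l0 l1 cE lz]]]] := delD J (enum_valP j).
  have tc k : j \notin a k -> (forall k', #|e k :&: c k'| = 1%N) /\
      (forall i, i \in e k -> 0 < z i -> exists k', i \in c k').
    rewrite inE => jk; apply: tight_covers (ez k) l0 l1 cE lz.
    by rewrite inE eE.
  pose P v (b : {set 'I_#|W|}) := v \in a i -> [/\ v \in b, j \in b &
    forall k, j \notin a k -> #|a k :&: b| = 1%N].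
  have /fin_all_exists[b bP] : forall v, exists b, P v b.
    move=> v; have [vai|vai] := boolP (v \in a i); last by exists set0 => h; rewrite h in vai.
    have [|k vk] := (tc i jai).2 (enum_val v) _ (proj1 (andP (zeta01 v))).
      by rewrite inE in vai.
    (* A cover through [v], with [J] adjoined; edges avoiding [J] do not see the change. *)
    exists [set w | enum_val w \in J |: c k] => _; split.
    - by rewrite !inE vk orbT.
    - by rewrite !inE eqxx.
    - move=> k' jk'; rewrite -[RHS]((tc _ jk').1 k) -(@card_enum_val_preim W (e k' :&: c k)).
        apply: eq_card => w; rewrite !inE; case: eqVneq => //= wJ.
        by move: jk'; rewrite inE -/J -wJ => /negbTE ->.
      exact: subset_trans (subsetIl _ _) (eW _).
  exact: row_size_le_col_size uM jai bP.
have lt_card (A : {set 'I_#|W|}) v : v \notin A -> (#|A| < #|W|)%N.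
  move=> vA; have /proper_card : A \proper setT.
    by rewrite properE subsetT; apply/subsetPn; exists v.
  by rewrite cardsT card_ord.
(* An empty column would let [zeta] vary at [j]; for a full column the indicator of [j] solves the
   system, so [zeta j] would be 1. *)
have ltc j : (0 < #|[set k | j \in a k]| < #|W|)%N.
  apply/andP; split.
    rewrite lt0n; apply/negP => /eqP /cards0_eq noj.
    have jN k : (j \in a k) = false by have := in_set0 k; rewrite -noj inE.
    have sum1 k : \sum_(v in a k) (zeta v + (v == j)%:R) = 1.
      rewrite big_split /= az big1 ?addr0 // => v.
      by case: eqVneq => [->|]; rewrite ?jN.
    have /eqP := zeta_uniq _ sum1 j.
    by rewrite eqxx -subr_eq0 addrC addKr oner_eq0.
  have [/existsP[k jk]|/existsPn allj] := boolP [exists k, j \notin a k].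
    by apply: (lt_card _ k); rewrite inE.
  have jT k : j \in a k by rewrite -[_ \in _]negbK allj.
  have sum1 k : \sum_(v in a k) (v == j)%:R = 1 :> F.
    by rewrite (bigD1 j) //= eqxx big1 ?addr0 // => v /andP[_ /negbTE ->].
  have /andP[_] := zeta01 j.
  by rewrite -(zeta_uniq _ sum1) eqxx ltxx.
(* Were row [k] full, an edge [k'] avoiding [j] would already have sum 1, forcing [zeta j = 0]. *)
have ltr k : (#|a k| < #|W|)%N.
  have [/existsP[v vk]|/existsPn fk] := boolP [exists v, v \notin a k].
    exact: lt_card vk.
  have full v : v \in a k by rewrite -[_ \in _]negbK fk.
  pose j := Ordinal N0.
  have [k' jk'] : exists k', j \notin a k'.
    apply/existsP; apply: contraT => /existsPn allj.
    have /andP[_] := ltc j; suff -> : [set k' | j \in a k'] = setT.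
      by rewrite cardsT card_ord ltnn.
    by apply/setP => k'; rewrite in_set in_setT; have := allj k'; rewrite negbK.
  have := az k; rewrite (bigID (fun v => v \in a k')) /=.
  have -> : \sum_(v in a k | v \in a k') zeta v = 1.
    by rewrite -(az k'); apply: eq_bigl => v; rewrite full.
  move/(canRL (addKr _)); rewrite addNr => s0.
  have zj : zeta j = 0.
    apply: (psumr_eq0P _ s0); last by rewrite full.
    by move=> v _; have /andP[/ltW] := zeta01 v.
  by have /andP[] := zeta01 j; rewrite zj ltxx.
have [y [kappa [kap0 y0 yk]]] := constant_column_weights F N0 ltr ltc le_rc.
case: pE => [E0|[s [c [sE disj cE cs]]]].
  by have := zE.2 _ E0; rewrite big_set0 ler10.
pose X := [set v : 'I_#|W| | enum_val v \in c].
have ge1 k : (1 <= #|a k :&: X|)%N.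
  have /is_coverP/(_ _ (eE k))[i ie ic] := cE.
  have iW := subsetP (eW k) _ ie.
  rewrite card_gt0; apply/set0Pn; exists (enum_rank_in iW i).
  by rewrite !inE enum_rankK_in // ie.
have weigh (x : 'I_#|W| -> F) :
    \sum_k y k * (\sum_(v in a k) x v) = kappa * \sum_v x v.
  under eq_bigr do rewrite mulr_sumr.
  rewrite (exchange_big_dep predT) //= mulr_sumr; apply: eq_bigr => v _.
  by rewrite -mulr_suml yk.
have sumX k : \sum_(v in a k) (v \in X)%:R = #|a k :&: X|%:R :> F.
  by rewrite sum_indic; congr (_%:R); apply: eq_card => v; rewrite !inE.
(* The disjoint edges of [s] each have [z]-weight at least 1, so the cover is no larger than the
   total weight. *)
have leX : \sum_v (v \in X)%:R <= \sum_v zeta v :> F.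
  have -> : \sum_v (v \in X)%:R = #|X|%:R :> F.
    rewrite -[LHS]/(\sum_(v in 'I_#|W|) (v \in X)%:R) sum_indic.
    by congr (_%:R); apply: eq_card => v; rewrite !inE.
  have leXs : (#|X| <= size s)%N.
    apply: leq_trans cs; rewrite -(card_imset _ enum_val_inj).
    by apply/subset_leq_card/subsetP => _ /imsetP[v + ->]; rewrite inE.
  have -> : \sum_v zeta v = \sum_(i in W) z i by exact/esym/big_enum_val.
  apply: le_trans (_ : (size s)%:R <= _); first by rewrite ler_nat.
  apply: le_trans (_ : \sum_(e <- s) \sum_(i in e) z i <= _).
    rewrite -sum1_size natr_sum big_seq [leRHS]big_seq.
    by apply: ler_sum => d /sE /(zE.2).
  rewrite big_seq (eq_bigr (fun d : {set T} => \sum_(i in W) (i \in d)%:R * z i)); last first.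
    move=> d /sE /edge_sub_cover dW.
    rewrite (eq_bigl (fun i => (i \in W) && (i \in d))) => [|i]; last first.
      by rewrite andb_idl // => /(subsetP dW).
    by rewrite big_mkcondr; apply: eq_bigr => i _; case: ifP; rewrite ?mul1r ?mul0r.
  rewrite -big_seq exchange_big /=; apply: ler_sum => i _.
  rewrite -mulr_suml -[leRHS]mul1r ler_wpM2r ?(zE.1) //.
  rewrite -natr_sum -[leRHS]/(1%:R) ler_nat; apply: leq_trans (disj i).
  by rewrite -sum1_count [leqRHS]big_mkcond.
have card1 k : #|a k :&: X| = 1%N.
  have pos k' : 0 <= y k' * (#|a k' :&: X|%:R - 1).
    by rewrite mulr_ge0 ?(ltW (y0 k')) // subr_ge0 ler1n.
  have tot : \sum_k' y k' * (#|a k' :&: X|%:R - 1) = 0.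
    apply/eqP; rewrite eq_le sumr_ge0 ?andbT //.
    have -> : \sum_k' y k' * (#|a k' :&: X|%:R - 1) =
        kappa * \sum_v (v \in X)%:R - kappa * \sum_v zeta v.
      rewrite -!weigh -sumrB; apply: eq_bigr => k' _.
      by rewrite sumX az mulrBr.
    by rewrite -mulrBr pmulr_rle0 // subr_le0.
  have /eqP : y k * (#|a k :&: X|%:R - 1) = 0.
    exact: (psumr_eq0P (fun k _ => pos k) tot).
  by rewrite mulf_eq0 gt_eqF //= subr_eq0 pnatr_eq1 => /eqP.
(* The indicator of [X] solves the system that determines [zeta], so [zeta] would be 0 or 1
   everywhere. *)
have := zeta_uniq (fun v => (v \in X)%:R) _ (Ordinal N0).
have /andP[] := zeta01 (Ordinal N0).
move=> + + h; rewrite -h => [|k]; last by rewrite sumX card1.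
by case: (_ \in X); rewrite ?ltxx.
Qed.

Lemma cover_deletion E j : cover (deletion E j) \subset cover E :\ j.
Proof.
apply/bigcupsP => e; rewrite inE => /andP[eE je].
by rewrite subsetD1 je edge_sub_cover.
Qed.

Lemma cover_contraction E j : cover (contraction E j) \subset cover E :\ j.
Proof.
by apply/bigcupsP => _ /imsetP[e eE ->]; rewrite setSD // edge_sub_cover.
Qed.

(** Induction on the number of vertices lying in edges: zero coordinates are contracted, coordinates
    at least 1 are deleted, and no other vertex of the polyhedron exists. *)
Theorem packing_dominates_covers E : packing E ->
  forall z, fractional_cover E z -> dominates_covers E z.
Proof.
have [k] := ubnP #|cover E|; elim: k E => // k IH E; rewrite ltnS => le_k pE.
have smaller E' j : j \in cover E -> cover E' \subset cover E :\ j -> (#|cover E'| < k)%N.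
  move=> jE /subset_leq_card; rewrite (cardsD1 j) jE add1n in le_k.
  by move/leq_ltn_trans; apply.
have del z j : fractional_cover E z -> j \in cover E -> dominates_covers (deletion E j) z.
  move=> zE jE; apply: IH; [|exact: packing_deletion|exact: fractional_cover_deletion].
  exact: smaller jE (cover_deletion E j).
have [N0|N0] := posnP #|cover E|.
  (* A fractional cover excludes the empty edge, so there are no edges and the empty set is a
     cover. *)
  move=> z [z0 zE]; exists unit, (fun _ => set0), (fun _ => 1); split=> //.
  - by rewrite big_const card_unit /= addr0.
  - move=> _; apply/is_coverP => e eE.
    have := zE _ eE; have := edge_sub_cover eE.
    by rewrite (cards0_eq N0) subset0 => /eqP ->; rewrite big_set0 ler10.
  - by move=> i; rewrite big1 // => k'; rewrite inE.
apply: dominates_covers_from_vertices => [z j zE jE|z zE z01 fullr].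
  case=> [zj|]; last exact/dominates_covers_deletion/del.
  apply: (@dominates_covers_contraction _ _ j).
  apply: IH; [|exact: packing_contraction|exact: fractional_cover_contraction].
  exact: smaller jE (cover_contraction E j).
have /eqP := packs_no_fractional_vertex (packing_packs pE) zE N0 z01 (fun j => del z j zE).
by rewrite fullr.
Qed.
End Clutters.

(** * Square-free monomial ideals *)

From mathcomp Require Import mpoly.
From mathcomp Require Import boolp classical_sets reals topology.
Import numFieldTopology.Exports.

(** Averaging the cover inequalities with the weights that lie below the constant 1/d bounds m by
    the sum of the [x i] divided by d. *)
Lemma packing_degree_bound (T : finType) (E : {set {set T}}) (x : T -> nat) (m d : nat) :
    packing E -> (0 < d)%N -> (forall e, e \in E -> (d <= #|e|)%N) ->
    (forall c, is_cover E c -> (m <= \sum_(i in c) x i)%N) ->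
  (m * d <= \sum_i x i)%N.
Proof.
move=> pE d0 dE mx.
have d0' : 0 < d%:R :> rat by rewrite ltr0n.
have zE : fractional_cover E (fun _ => d%:R^-1 : rat).
  split=> [i|e /dE de]; first by rewrite invr_ge0 ler0n.
  by rewrite sumr_const -[leRHS]mulr_natr ler_pdivlMl // mulr1 ler_nat.
have [I [c [l [l0 l1 cE lz]]]] := packing_dominates_covers pE zE.
rewrite -(ler_nat rat) natrM -ler_pdivlMr //.
apply: le_trans (_ : \sum_i (x i)%:R * \sum_(k | i \in c k) l k <= _).
  under eq_bigr do rewrite mulr_sumr.
  rewrite (exchange_big_dep predT) //= -[leLHS]mulr1 -[X in _ * X <= _]l1 mulr_sumr.
  apply: ler_sum => k _; rewrite -mulr_suml ler_wpM2r ?(ltW (l0 k)) //.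
  by rewrite -natr_sum ler_nat mx.
rewrite natr_sum mulr_suml; apply: ler_sum => i _.
by rewrite ler_wpM2l // ler0n.
Qed.

Lemma count_le1 (T : eqType) (P : pred T) (s : seq T) :
  uniq s -> (forall x y, x \in s -> y \in s -> P x -> P y -> x = y) ->
  (count P s <= 1)%N.
Proof.
move=> us inj; rewrite -size_filter.
have := filter_uniq P us; have := mem_filter P ^~ s.
case: (seq.filter P s) => [|x [|y t]] // mem_f.
rewrite /= inE negb_or => /andP[/andP[/eqP xy _] _].
have /andP[Px xs] : P x && (x \in s) by rewrite -mem_f inE eqxx.
have /andP[Py ys] : P y && (y \in s) by rewrite -mem_f !inE eqxx orbT.
by case: xy; apply: inj.
Qed.

Section Ideals.
Variables (K : fieldType) (n : nat).
Implicit Types (S J : set {mpoly K[n]}) (E D : {set {set 'I_n}}) (A e Z U : {set 'I_n}).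

(** * Generated ideals and monomial membership *)

Lemma ideal_gen_mem S g : S g -> ideal_gen S g.
Proof.
by move=> Sg; exists 1%N, (fun=> 1), (fun=> g); rewrite big_ord1 mul1r.
Qed.

Lemma ideal_gen0 S : ideal_gen S 0.
Proof.
exists 0%N, (fun=> 0), (fun=> 0); split; [by case|by rewrite big_ord0].
Qed.

Lemma ideal_genD S p q : ideal_gen S p -> ideal_gen S q -> ideal_gen S (p + q).
Proof.
move=> [k [c [g [Sg ->]]]] [k' [c' [g' [Sg' ->]]]].
exists (k + k')%N,
  (fun i => match split i with inl j => c j | inr j => c' j end),
  (fun i => match split i with inl j => g j | inr j => g' j end).
split=> [i|]; first by case: (split i).
rewrite big_split_ord; congr (_ + _); apply: eq_bigr => i _.
  by rewrite (unsplitK (inl i)).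
by rewrite (unsplitK (inr i)).
Qed.

Lemma ideal_genM S p q : ideal_gen S q -> ideal_gen S (p * q).
Proof.
move=> [k [c [g [Sg ->]]]]; exists k, (fun i => p * c i), g; split=> //.
by rewrite mulr_sumr; apply: eq_bigr => i _; rewrite mulrA.
Qed.

Lemma ideal_gen_sub S S' p :
  (forall g, S g -> ideal_gen S' g) -> ideal_gen S p -> ideal_gen S' p.
Proof.
move=> SS' [k [c [g [Sg ->]]]].
elim/big_ind: _ => [|x y|i _]; [exact: ideal_gen0|exact: ideal_genD|].
exact/ideal_genM/SS'.
Qed.

Lemma ideal_gen_monomialP (G : set 'X_{1..n}) (p : {mpoly K[n]}) :
  ideal_gen [set 'X_[a] | a in G]%classic p <->
  (forall a, a \in msupp p -> exists2 g, G g & (g <= a)%MM).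
Proof.
split=> [[k [c [f [Gf ->]]]]|h].
  elim/big_ind: _ => [a|x y hx hy a|i _ a].
  - by rewrite -mpolyC0 msupp0.
  - by move/msuppD_le; rewrite mem_cat => /orP[/hx|/hy].
  have [g Gg <-] := Gf i; move/msuppM_le/allpairsP => [[a1 a2] /= [_ + ->]].
  rewrite msuppX inE => /eqP ->; exists g => //.
  by apply/mnm_lepP => j; rewrite mnmDE leq_addl.
rewrite [p]mpolyE big_seq.
elim/big_ind: _ => [|x y|a /h[g Gg ga]]; [exact: ideal_gen0|exact: ideal_genD|].
rewrite -mul_mpolyC -(submK ga) mpolyXD mulrA; apply/ideal_genM/ideal_gen_mem.
by exists g.
Qed.

(** * Edge ideals, covers and minimal primes *)

Lemma mesym1_lep e (a : 'X_{1..n}) :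
  (mesym1 e <= a)%MM = (e \subset [set i | a i != 0%N]).
Proof.
apply/mnm_lepP/fintype.subsetP => [h i ie|h i].
  by have := h i; rewrite mnmE ie inE lt0n.
by rewrite mnmE; case: (boolP (i \in e)) => // /h; rewrite inE lt0n.
Qed.

(** [mesym1 e] is the exponent of the product of the variables in [e]. [E] may contain nested edges,
    so minors need no reduction to minimal ones. *)
Definition edge_ideal E : set {mpoly K[n]} :=
  ideal_gen [set 'X_[a] | a in [set mesym1 e | e in [set` E]]]%classic.

Lemma edge_idealP E (p : {mpoly K[n]}) :
  edge_ideal E p <->
  (forall a, a \in msupp p -> exists2 e, e \in E & e \subset [set i | a i != 0%N]).
Proof.
split=> [/ideal_gen_monomialP h a /h[_ [e eE <-]]|h].
  by rewrite mesym1_lep; exists e.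
apply/ideal_gen_monomialP => a /h[e eE ea].
by exists (mesym1 e); rewrite ?mesym1_lep //; exists e.
Qed.

Lemma edge_ideal_monomial E (a : 'X_{1..n}) :
  edge_ideal E 'X_[a] <-> exists2 e, e \in E & e \subset [set i | a i != 0%N].
Proof.
rewrite edge_idealP; split=> [|h b]; first by apply; rewrite msuppX inE.
by rewrite msuppX inE => /eqP ->.
Qed.

Lemma squarefree_edge_ideal I :
  @squarefree_monomial_ideal K n I -> exists E, I = edge_ideal E.
Proof.
move=> [G sqG ->]; exists [set e | `[< G (mesym1 e) >]].
congr ideal_gen; congr image; apply/seteqP; split=> [a Ga|_ [e + <-]].
  have aE : mesym1 [set i | a i != 0%N] = a.
    by apply/mnmP => i; rewrite mnmE inE; have := sqG a Ga i; case: (a i) => [|[]].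
  by exists [set i | a i != 0%N] => //=; rewrite inE aE; apply/asboolP.
by rewrite /= inE => /asboolP.
Qed.

Lemma edge_ideal_set0 E : finset.set0 \in E -> edge_ideal E = setT.
Proof.
move=> E0; apply/seteqP; split=> // p _; apply/edge_idealP => a _.
by exists finset.set0; rewrite ?finset.sub0set.
Qed.

Lemma edge_ideal_eqT E : edge_ideal E = setT -> finset.set0 \in E.
Proof.
move=> ET; have /edge_ideal_monomial[e eE] : edge_ideal E 'X_[0%MM] by rewrite ET.
have -> : [set i | (0%MM : 'X_{1..n}) i != 0%N] = finset.set0.
  by apply/setP => i; rewrite !inE mnm0E.
by rewrite finset.subset0 => /eqP <-.
Qed.

Lemma edge_ideal_eq0 E : edge_ideal E = [set 0]%classic -> E = finset.set0.
Proof.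
move=> EI; apply/setP => e; rewrite inE; apply/negP => eE.
have : edge_ideal E 'X_[mesym1 e].
  apply/edge_ideal_monomial; exists e => //.
  by apply/fintype.subsetP => i ie; rewrite inE mnmE ie.
by rewrite EI /= => /(congr1 (@msupp _ _)); rewrite msuppX -mpolyC0 msupp0.
Qed.

Lemma var_primeP A (p : {mpoly K[n]}) :
  var_prime A p <-> (forall a, a \in msupp p -> exists2 i, i \in A & a i != 0%N).
Proof.
rewrite /var_prime.
have -> : [set 'X_i | i in [set` A]]%classic =
    [set 'X_[a] | a in [set U_(i)%MM | i in [set` A]]]%classic :> set {mpoly K[n]}.
  apply/seteqP; split=> [_ [i iA <-]|_ [_ [i iA <-] <-]]; last by exists i.
  by exists U_(i)%MM => //; exists i.
split=> [/ideal_gen_monomialP h a /h[_ [i iA <-]]|h].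
  by rewrite lep1mP; exists i.
apply/ideal_gen_monomialP => a /h[i iA ai].
by exists U_(i)%MM; rewrite ?lep1mP //; exists i.
Qed.

(** The degree in the variables of [A] adds up under products and is at least 1 on each monomial of
    an element of the prime. *)
Lemma var_prime_exp A m (p : {mpoly K[n]}) a :
  ideal_exp (var_prime A) m p -> a \in msupp p -> (m <= \sum_(i in A) a i)%N.
Proof.
pose ord k (q : {mpoly K[n]}) := forall a, a \in msupp q -> (k <= \sum_(i in A) a i)%N.
have ordM k l q r : ord k q -> ord l r -> ord (k + l)%N (q * r).
  move=> hq hr b /msuppM_le /allpairsP[[a1 a2] /= [/hq h1 /hr h2 ->]].
  under eq_bigr do rewrite mnmDE.
  by rewrite big_split leq_add.
have ord0 q : ord 0%N q by [].
have ord1 q : var_prime A q -> ord 1%N q.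
  move=> /var_primeP h b /h[i iA bi].
  by rewrite (bigD1 i) //= addn_gt0 lt0n bi.
suff: ideal_exp (var_prime A) m p -> ord m p by move=> h /h; apply.
move=> [k [c [f [hf ->]]]].
elim/big_ind: _ => [b|q r hq hr b|j _]; first by rewrite -mpolyC0 msupp0.
  by move/msuppD_le; rewrite mem_cat => /orP[/hq|/hr].
apply: (ordM 0%N m) => //; have [g [Ag ->]] := hf j.
elim: m g Ag {hf f c k j p} => [g _|m IH g Ag]; first by rewrite big_ord0.
by rewrite big_ord_recl; apply: (ordM 1%N m); [exact: ord1|apply: IH].
Qed.

(** If the support of a monomial contains no edge, its complement is a cover whose prime misses that
    monomial. *)
Lemma edge_ideal_covers E :
  edge_ideal E = (\bigcap_(A in [set` finset (is_cover E)]) var_prime A)%classic.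
Proof.
apply/seteqP; split=> [p /edge_idealP h A|p h].
  rewrite /= inE => /is_coverP cA; apply/var_primeP => a /h[e eE /fintype.subsetP ea].
  have [i ie iA] := cA e eE; exists i => //.
  by have := ea i ie; rewrite inE.
apply/edge_idealP => a ap.
have [/existsP[e /andP[eE ea]]|/existsPn no] :=
  boolP [exists e, (e \in E) && (e \subset [set i | a i != 0%N])]; first by exists e.
have cA : is_cover E [set i | a i == 0%N].
  apply/is_coverP => e eE; have := no e; rewrite eE /= => /subsetPn[i ie].
  by rewrite inE negbK => ai; exists i; rewrite // inE.
have /var_primeP/(_ a ap) : var_prime [set i | a i == 0%N] p by apply: h; rewrite /= inE.
by move=> [i]; rewrite inE => /eqP ->.
Qed.

(** Existence suffices for [xget]: a family of least cardinality among those with the right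
    intersection is irredundant. *)
Lemma decomposition_edge_ideal E :
  edge_ideal E = (\bigcap_(A in [set` decomposition (edge_ideal E)]) var_prime A)%classic.
Proof.
suff /(xgetPex finset.set0) [] : exists D, irredundant_decomposition (edge_ideal E) D by [].
pose P D := `[< edge_ideal E = (\bigcap_(A in [set` D]) var_prime A)%classic >].
have P0 : P (finset (is_cover E)) by apply/asboolP; exact: edge_ideal_covers.
case: (arg_minnP (fun D => #|D|) P0) => D /asboolP PD minD.
exists D; split=> // B BD DB.
have /minD : P (D :\ B) by apply/asboolP.
by rewrite [leqLHS](cardsD1 B) BD add1n ltnn.
Qed.

Lemma decomposition_cover E A : A \in decomposition (edge_ideal E) -> is_cover E A.
Proof.
move=> AD; apply/is_coverP => e eE.
have : edge_ideal E 'X_[mesym1 e].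
  apply/edge_ideal_monomial; exists e => //.
  by apply/fintype.subsetP => i ie; rewrite inE mnmE ie.
rewrite decomposition_edge_ideal => /(_ A AD) /var_primeP /(_ (mesym1 e)).
rewrite msuppX inE eqxx => /(_ isT) [i iA]; rewrite mnmE.
by case: (boolP (i \in e)) => // ie _; exists i.
Qed.

(** Otherwise the product of the variables outside [c] lies in every prime of the decomposition,
    hence in the ideal, and some edge misses [c]. *)
Lemma cover_decomposition E c :
  is_cover E c -> exists2 A, A \in decomposition (edge_ideal E) & A \subset c.
Proof.
move=> cE.
have [/existsP[A /andP[AD Ac]]|/existsPn no] :=
  boolP [exists A, (A \in decomposition (edge_ideal E)) && (A \subset c)]; first by exists A.
have /edge_ideal_monomial[e eE /fintype.subsetP ea] : edge_ideal E 'X_[mesym1 (~: c)].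
  rewrite decomposition_edge_ideal => A /= AD.
  apply/var_primeP => a; rewrite msuppX inE => /eqP ->.
  have := no A; rewrite AD /= => /subsetPn[i iA ic].
  by exists i; rewrite // mnmE inE ic.
have /is_coverP/(_ e eE)[i /ea + ic] := cE.
by rewrite inE mnmE inE ic.
Qed.

(** * From the Konig and packing properties of ideals to those of clutters *)

Lemma height_cover E : finset.set0 \notin E ->
  exists2 c, is_cover E c & (#|c| <= height (edge_ideal E))%N.
Proof.
move=> E0; rewrite /height; elim/big_ind: _ => [|x y|A AD].
(* The initial value [n] of the minimum is the size of the full vertex set, a cover since no edge is
   empty. *)
- exists finset.setT; last by rewrite cardsT card_ord.
  apply/is_coverP => e eE; have /set0Pn[i ie] : e != finset.set0.
    by apply: contraNneq E0 => <-.
  by exists i; rewrite // inE.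
- by move=> [c cE cx] [c' c'E cy]; rewrite /minn; case: ifP; [exists c|exists c'].
- by exists A => //; apply: decomposition_cover.
Qed.

Lemma konig_packs E : konig (edge_ideal E) -> packs E.
Proof.
have [E0|E0] := boolP (finset.set0 \in E); first by left.
case=> [/edge_ideal_eq0 ->|/edge_ideal_eqT|[s [us hs sE cop]]].
- right; exists [::], finset.set0; split=> //; last by rewrite cards0.
  by apply/is_coverP => e; rewrite inE.
- by rewrite (negbTE E0).
right; have [c cE cs] := height_cover E0.
(* [f] picks an edge inside the support of each monomial of [s]; coprime monomials get disjoint
   edges. *)
have /choice[f fP] : forall a, exists e, a \in s ->
    e \in E /\ e \subset [set i : 'I_n | a i != 0%N].
  move=> a; have [/sE/edge_ideal_monomial[e eE ea]|_] := boolP (a \in s); first by exists e.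
  by exists finset.set0.
exists (map f s), c; split=> [_ /mapP[a /fP[? _] ->] //|i|//|]; last by rewrite size_map hs.
rewrite count_map; apply: count_le1 => // a b aS bS /= ia ib.
apply/eqP; apply: contraT => /(cop a b aS bS) /(_ i).
have := fintype.subsetP (fP a aS).2 i ia; have := fintype.subsetP (fP b bS).2 i ib.
by rewrite !inE => /eqP ? /eqP ? [].
Qed.

Lemma specialize_edge_ideal E Z U : [disjoint Z & U]%B ->
  specialize Z U (edge_ideal E) = edge_ideal (minor E Z U).
Proof.
move=> ZU; rewrite /specialize; set v := [tuple _ | _ < _].
have vX e : 'X_[mesym1 e] \mPo v =
    if [disjoint e & Z]%B then 'X_[mesym1 (e :\: U)] else 0 :> {mpoly K[n]}.
  rewrite comp_mpolyX; have [eZ|] := boolP [disjoint e & Z]%B; last first.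
    rewrite -finset.setI_eq0 => /set0Pn[i]; rewrite inE => /andP[ie iZ].
    by rewrite (bigD1 i) //= tnth_mktuple mnmE iZ ie expr1 mul0r.
  rewrite mpolyXE_id; apply: eq_bigr => i _; rewrite tnth_mktuple !mnmE inE.
  have [ie|ie] := boolP (i \in e); last by rewrite andbF !expr0.
  rewrite (disjointFr eZ ie) andbT; by case: (i \in U).
apply/seteqP; split=> p; apply: ideal_gen_sub => r.
  move=> [q [k [c [g [gE ->]]]] <-].
  rewrite rmorph_sum; elim/big_ind: _ => [|x y|i _]; [exact: ideal_gen0|exact: ideal_genD|].
  rewrite rmorphM; apply: ideal_genM.
  have [_ [e eE <-] <-] := gE i; rewrite /= vX.
  case: ifP => eZ; last exact: ideal_gen0.
  apply: ideal_gen_mem; exists (mesym1 (e :\: U)) => //; exists (e :\: U) => //.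
  by apply/imsetP; exists e => //; rewrite inE eE.
move=> [_ [e /imsetP[e' + ->] <-] <-]; rewrite inE => /andP[e'E eZ].
apply: ideal_gen_mem; exists 'X_[mesym1 e']; last by rewrite vX eZ.
by apply: ideal_gen_mem; exists (mesym1 e') => //; exists e'.
Qed.

Lemma packing_property_packing E : packing_property (edge_ideal E) -> packing E.
Proof.
by move=> pI Z U ZU; apply: konig_packs; rewrite -specialize_edge_ideal //; apply: pI.
Qed.

(** * Initial degrees of edge ideals and their symbolic powers *)

Lemma initial_degree_eq J d :
    (exists2 p, J p & p != 0 /\ (msize p).-1 = d) ->
    (forall p, J p -> p != 0 -> (d <= (msize p).-1)%N) ->
  initial_degree J = d.
Proof.
move=> Jd mind; rewrite /initial_degree; set P := (X in xget _ X).
have /(xgetPex 0%N) [[p Jp [p0 <-]] minx] : exists x, P x by exists d.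
have [q Jq [q0 qd]] := Jd.
by apply/eqP; rewrite eqn_leq mind // andbT -qd; exact: minx.
Qed.

Lemma initial_degree_symbolic_power E d m :
    packing E -> (0 < d)%N ->
    (exists2 e, e \in E & #|e| = d) -> (forall e, e \in E -> (d <= #|e|)%N) ->
  initial_degree (symbolic_power (edge_ideal E) m) = (m * d)%N.
Proof.
move=> pE d0 [e eE ed] mind; apply: initial_degree_eq => [|p Ip p0].
  (* The power of a smallest generator attains the bound: every prime of the decomposition is a
     cover, so it contains that generator. *)
  exists ('X_[mesym1 e] ^+ m); last first.
    by rewrite mpolyXn -msupp_eq0 msuppX msizeX mdegMn mdeg_mesym1 ed mulnC.
  move=> A AD; apply: ideal_gen_mem; exists (fun=> 'X_[mesym1 e]); split; last first.
    by rewrite prodr_const card_ord.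
  move=> _; apply/var_primeP => a; rewrite msuppX inE => /eqP ->.
  have /is_coverP/(_ e eE)[i ie iA] := decomposition_cover AD.
  by exists i; rewrite // mnmE ie.
have ap := mlead_supp p0; set a := mlead p in ap.
rewrite -ltnS (ltn_predK (msize_mdeg_lt ap)); apply: leq_ltn_trans (msize_mdeg_lt ap).
(* Each cover contains a set of the decomposition, on which the exponent already sums to at least
   [m]. *)
rewrite mdegE; apply: packing_degree_bound (pE) d0 mind _ => c /cover_decomposition[A AD Ac].
apply: leq_trans (var_prime_exp (Ip A AD) ap) _.
rewrite [leqRHS](bigID (fun i => i \in A)) /=.
rewrite (eq_bigl (fun i => (i \in c) && (i \in A))) ?leq_addr // => i.
by rewrite andb_idl // => /(fintype.subsetP Ac).
Qed.

Lemma initial_degree_edge_ideal E d :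
    (exists2 e, e \in E & #|e| = d) -> (forall e, e \in E -> (d <= #|e|)%N) ->
  initial_degree (edge_ideal E) = d.
Proof.
move=> [e eE ed] mind; apply: initial_degree_eq => [|p /edge_idealP Ip p0].
  exists 'X_[mesym1 e].
    apply/edge_ideal_monomial; exists e => //.
    by apply/fintype.subsetP => i ie; rewrite inE mnmE ie.
  by rewrite -msupp_eq0 msuppX msizeX mdeg_mesym1.
have ap := mlead_supp p0; set a := mlead p in ap.
rewrite -ltnS (ltn_predK (msize_mdeg_lt ap)); apply: leq_ltn_trans (msize_mdeg_lt ap).
have [e' e'E /fintype.subsetP ea] := Ip _ ap; apply: leq_trans (mind _ e'E) _.
rewrite mdegE -sum1_card big_mkcond; apply: leq_sum => i _.
by case: ifP => // /ea; rewrite inE lt0n.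
Qed.

End Ideals.

Local Open Scope classical_set_scope.

Theorem theorem4p3 (R : realType) (K : fieldType) (n : nat)
    (I : set (mpoly.mpoly n K))
    (I_sqfree : squarefree_monomial_ideal I)
    (I_neq0 : I <> [set 0]) (I_proper : I <> setT)
    (I_packing : packing_property I) :
  waldschmidt R I = (initial_degree I)%:R.
Proof.
have [E IE] := squarefree_edge_ideal I_sqfree; subst I.
have pE := packing_property_packing I_packing.
have E0 : finset.set0 \notin E by apply/negP => /edge_ideal_set0.
have [e0 e0E] : exists e, e \in E.
  apply/set0Pn/eqP => EE; apply: I_neq0; apply/seteqP; split=> p /=.
    move/edge_idealP; rewrite EE => h; apply/eqP; rewrite -msupp_eq0.
    case: (msupp p) h => // a s /(_ a); rewrite inE eqxx => /(_ isT)[e].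
    by rewrite inE.
  by move=> ->; exact: ideal_gen0.
case: (arg_minnP (fun e : {set 'I_n} => #|e|) e0E) => e eE mind.
have emin : exists2 e', e' \in E & #|e'| = #|e| by exists e.
have d0 : (0 < #|e|)%N.
  by rewrite card_gt0; apply: contraNneq E0 => <-.
rewrite (initial_degree_edge_ideal K emin mind) /waldschmidt.
(* The sequence is constant only from index 1 on, its term at 0 being 0. *)
apply: (lim_near_cst (@Rhausdorff R)); exists 1%N => // m /= m0.
rewrite (initial_degree_symbolic_power K _ pE d0 emin mind).
by rewrite natrM mulrAC divff ?mul1r // pnatr_eq0 -lt0n.
Qed.
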